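(* Let $X$ be a discrete random variable with values in $\mathbb{Z}$ and probabilities $p_j=\mathbf{P}[X=j]>0$ for all $j\in\mathbb{Z}$, $\sum_{j\in\mathbb{Z}}p_j=1$. Suppose that $X$ is symmetric (i.e. $p_{-j}=p_j$ for all $j$), that all its moments are finite ($\mathbf{E}[|X|^k]<\infty$ for all $k=1,2,\ldots$), and that for some integer $j_0\ge 2$ $$\sum_{|j|\ge j_0}\frac{-\ln p_j}{j^2\,\ln|j|}=\infty .$$ Assume further that the sequence $\dfrac{-\ln p_j}{\ln j}$, $j=j_0,j_0+1,\ldots$, is monotone increasing and tends to $\infty$ as $j\to\infty$. Then $X$ satisfies Carleman's condition (Hamburger case), $\sum_{k=1}^\infty(\mathbf{E}[X^{2k}])^{-1/(2k)}=\infty$, and hence $X$ is M-determinate (on $\mathbb{R}$). Moreover, $X^2$ is M-determinate on $\mathbb{R}_+=[0,\infty)$.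
   Context: A random variable with values in $\mathbb{R}$ and all moments finite is called M-determinate on $\mathbb{R}$ if its distribution is the only probability distribution on $\mathbb{R}$ having its moment sequence. A random variable with values in $\mathbb{R}_+=[0,\infty)$ and all moments finite is called M-determinate on $\mathbb{R}_+$ if its distribution is the only probability distribution on $\mathbb{R}_+$ having its moment sequence. ''Monotone increasing'' is understood in the usual sense of non-decreasing. *)

(* Defs.v *)
From HB Require Import structures.
From mathcomp Require Import all_boot all_order all_algebra.
From mathcomp Require Import all_classical all_reals all_analysis.

Set Implicit Arguments.
Unset Strict Implicit.
Unset Printing Implicit Defensive.

Import Order.TTheory GRing.Theory Num.Theory.
Import numFieldNormedType.Exports.

Local Open Scope classical_set_scope.
Local Open Scope ring_scope.
Local Open Scope ereal_scope.

Definition finite_moments d (T : measurableType d) (R : realType)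
    (P : probability T R) (X : {RV P >-> R}) : Prop :=
  forall k : nat, (0 < k)%N -> 'E_P[fun t => (`|X t| ^+ k)%R] < +oo.
Arguments finite_moments {d T R} P X.

(* The integrability clause expresses that the moments of mu exist. *)
Definition has_moments_of d (T : measurableType d) (R : realType)
    (P : probability T R) (X : {RV P >-> R})
    (mu : probability R R) : Prop :=
  forall k : nat,
    mu.-integrable [set: R] (fun x => (x ^+ k)%:E) /\
    \int[mu]_x (x ^+ k)%:E = 'E_P[fun t => (X t ^+ k)%R].
Arguments has_moments_of {d T R} P X mu.

Definition M_determinate_on d (T : measurableType d) (R : realType)
    (S : set R) (P : probability T R) (X : {RV P >-> R}) : Prop :=
  [/\ forall t, S (X t),
      finite_moments P X &
      forall mu : probability R R,
        mu S = 1 -> has_moments_of P X mu ->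
        forall A : set R, measurable A ->
          mu A = distribution P X A].
Arguments M_determinate_on {d T R} S P X.

(* The inverse is the one of \bar R (0^-1 = +oo and +oo^-1 = 0), so that
   (E `^ r)^-1 is E to the power -r for every E in [0, +oo]; E `^ (- r) would
   give 0 at E = 0 and +oo at E = +oo. *)
Definition Carleman_Hamburger d (T : measurableType d) (R : realType)
    (P : probability T R) (X : {RV P >-> R}) : Prop :=
  \sum_(1 <= k <oo)
    ('E_P[fun t => (X t ^+ (2 * k)%N)%R] `^ ((2 * k)%:R^-1)%R)^-1 = +oo.
Arguments Carleman_Hamburger {d T R} P X.

(* Main.v *)
Require Import Defs.
From HB Require Import structures.
From mathcomp Require Import all_boot all_order all_algebra.
From mathcomp Require Import all_classical all_reals all_analysis.
From mathcomp Require Import measurable_realfun ring lra.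
Import Order.TTheory GRing.Theory Num.Theory.
Import numFieldNormedType.Exports.
Local Open Scope classical_set_scope.
Local Open Scope ring_scope.

(** Write q j = - ln p_j / ln j, let J_n be the first j >= j0 with q j >= n + 2
    and M_n = J_1 ... J_n.  Since p_j = j^(- q j), one has j^(n+2) p_j <= M_n
    for j >= J_0, whence E|X|^n <= 3 M_n; and q j <= 4 + 2 #{k : J_(2k+2) <= j}
    turns the divergence of sum q j / j^2 into that of sum 1 / J_(2k), which is
    Carleman's condition because M_n <= J_n^n.

    Determinacy follows Bang's proof of the Denjoy-Carleman theorem.  Let
    g_n(t) be the difference of the integrals of x^n cos(t x + s + n pi/2) with
    respect to two measures with equal moments.  All g_n vanish at 0, and a
    Taylor step of length at most 1 / (4 J_(2k)) only costs a factor 4 in the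
    bound |g_n| <= C 2^(n-2k) M_n (n < 2k); as these lengths have infinite sum,
    g_0 vanishes on [0, oo).  The trigonometric polynomials
    cos((x - c)/n)^(n^3) are bounded and tend to the indicator of {c}, so both
    measures have the same atoms, and X is purely atomic.

    For X^2, apply this with s = 0 to |X| and to the square root of the competing
    variable: then the odd moments are multiplied by cos(n pi/2) = 0. *)

(** * Taylor bounds for the cosine *)

Lemma ge0_of_derive_ge0 (R : realType) (f df : R -> R) :
  (forall t : R, is_derive t (1 : R) f (df t)) -> (forall t, 0 <= t -> 0 <= df t) ->
  f 0 = 0 -> forall h, 0 <= h -> 0 <= f h.
Proof.
move=> fd df0 f0 h h0.
have cf : {within `[0, h], continuous f}.
  apply: continuous_subspaceT => x.
  by apply/differentiable_continuous/derivable1_diffP; case: (fd x).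
have [c] := @MVT_segment R f df 0 h h0 (fun x _ => fd x) cf.
rewrite f0 !subr0 in_itv/= => /andP[c0 _] ->.
by rewrite mulr_ge0// df0.
Qed.

Lemma norm_le_of_derive (R : realType) (f df : R -> R) (K : R) (m : nat) :
  (forall t : R, is_derive t (1 : R) f (df t)) ->
  (forall t, 0 <= t -> `|df t| <= K * t ^+ m) ->
  f 0 = 0 -> forall h, 0 <= h -> `|f h| <= K * h ^+ m.+1 / m.+1%:R.
Proof.
move=> fd dfK f0 h h0.
have dK (t : R) : is_derive t 1 (fun h : R => K * h ^+ m.+1 / m.+1%:R) (K * t ^+ m).
  rewrite (_ : (fun h : R => _) = horner ((K / m.+1%:R) *: 'X^(m.+1))); last first.
    by apply/funext => x; rewrite hornerZ hornerXn mulrAC.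
  apply: is_derive_eq; rewrite derivZ derivXn/= hornerZ hornerMn hornerXn.
  by rewrite -[t ^+ m *+ _]mulr_natr mulrA mulrAC divfK// pnatr_eq0.
rewrite ler_norml; apply/andP; split.
- rewrite -subr_ge0 opprK.
  apply: (@ge0_of_derive_ge0 R (f + (fun h : R => K * h ^+ m.+1 / m.+1%:R))
    (fun t => df t + K * t ^+ m)) => //.
  + by move=> t /dfK; rewrite ler_norml => /andP[+ _]; rewrite -subr_ge0 opprK.
  + by rewrite !fctE f0 expr0n/= mulr0 mul0r addr0.
- rewrite -subr_ge0.
  apply: (@ge0_of_derive_ge0 R ((fun h : R => K * h ^+ m.+1 / m.+1%:R) - f)
    (fun t => K * t ^+ m - df t)) => //.
  + by move=> t /dfK; rewrite ler_norml => /andP[_]; rewrite -subr_ge0.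
  + by rewrite !fctE f0 expr0n/= mulr0 mul0r subr0.
Qed.

(** Induction on the order with the phase [a] free: since the derivative of cos is cos(. + pi/2),
    differentiating the remainder of order m + 1 in [h] gives [x] times the remainder of order m at
    phase a + pi/2. The bound is then integrated by [norm_le_of_derive]. *)
Lemma cos_taylor (R : realType) (m : nat) (a x h : R) : 0 <= h ->
  `|cos (a + h * x) - \sum_(i < m) cos (a + i%:R * (pi / 2)) * (h * x) ^+ i / i`!%:R|
  <= (h * `|x|) ^+ m / m`!%:R.
Proof.
elim: m a h => [|m IH] a h h0.
  by rewrite big_ord0 subr0 expr0 mul1r fact0 invr1 cos_max.
pose f h := cos (a + h * x) - \sum_(i < m.+1) cos (a + i%:R * (pi / 2)) * (h * x) ^+ i / i`!%:R.
pose df h := x * (cos ((a + pi / 2) + h * x) -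
  \sum_(i < m) cos ((a + pi / 2) + i%:R * (pi / 2)) * (h * x) ^+ i / i`!%:R).
have := @norm_le_of_derive R f df (`|x| ^+ m.+1 / m`!%:R) m.
have fd (t : R) : is_derive t 1 f (df t).
  pose p := \sum_(i < m.+1) (cos (a + i%:R * (pi / 2)) * x ^+ i / i`!%:R) *: 'X^i.
  have -> : f = (fun h => cos (a + h * x)) - horner p.
    apply/funext => u; rewrite -[RHS]/(cos (a + u * x) - p.[u]) /f /p horner_sum; congr (_ - _).
    by apply: eq_bigr => i _; rewrite hornerZ hornerXn exprMn; lra.
  have Dc : is_derive t (1 : R) (fun h => cos (a + h * x)) (x * cos (a + pi / 2 + t * x)).
    rewrite (_ : (fun h => _) = cos \o horner (a%:P + x *: 'X)); last first.
      by apply/funext => u/=; rewrite !hornerE mulrC.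
    have -> : x * cos (a + pi / 2 + t * x) =
        - sin (horner (a%:P + x *: 'X) t) * ((a%:P + x *: 'X)^`()).[t].
      rewrite derivD derivC derivZ derivX !hornerD !hornerZ !hornerC !hornerX addrAC cosDpihalf [t * x]mulrC.
      by ring.
    exact: is_derive1_comp.
  apply: is_derive_eq; rewrite /df mulrBr; congr (_ - _).
  rewrite /p raddf_sum/= horner_sum big_ord_recl/= derivZ derivXn/= hornerZ mulr0n horner0 mulr0 add0r.
  rewrite mulr_sumr; apply: eq_bigr => i _.
  rewrite derivZ derivXn/= hornerZ hornerMn hornerXn /bump leq0n add1n.
  rewrite (_ : a + i.+1%:R * _ = a + pi / 2 + i%:R * (pi / 2)); last by rewrite -natr1; lra.
  rewrite factS natrM invfM exprS exprMn -mulr_natr.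
  set c := cos _; set k := (i`!%:R)^-1.
  have : i.+1%:R != 0 :> R by rewrite pnatr_eq0.
  by set q := i.+1%:R => q0; field.
move=> /(_ fd); rewrite -/(f h) => H.
rewrite (le_trans (H _ _ _ h0))//.
- move=> t t0; rewrite /df normrM exprS -!mulrA ler_wpM2l//.
  by rewrite (le_trans (IH _ _ t0))// exprMn; lra.
- rewrite /f big_ord_recl big1 => [|i _]; last first.
    by rewrite mul0r exprS mul0r mulr0 mul0r.
  by rewrite !mul0r expr0 fact0 divr1 mulr1 !addr0 subrr.
- by rewrite exprMn factS natrM invfM; rewrite le_eqVlt; apply/orP; left; apply/eqP; ring.
Qed.

Lemma sum_half_le2 (R : realType) (m : nat) : \sum_(i < m) (2^-1 : R) ^+ i <= 2.
Proof.
suff -> : \sum_(i < m) (2^-1 : R) ^+ i = 2 - 2 * 2^-1 ^+ m.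
  by rewrite gerBl mulr_ge0// exprn_ge0// invr_ge0.
elim: m => [|m IH]; first by rewrite big_ord0 expr0 mulr1 subrr.
by rewrite big_ord_recr/= IH exprS; lra.
Qed.

(** * Bang's vanishing argument *)

Section bang.
Context {R : realType}.
Variables (g : nat -> R -> R) (J : nat -> R) (C : R).
Hypothesis C0 : 0 <= C.
Hypothesis J0 : forall n, 0 < J n.
Hypothesis Jnd : forall m n, (m <= n)%N -> J m <= J n.
Let M n := \prod_(i < n) J i.
Hypothesis g00 : forall n, g n 0 = 0.
Hypothesis gT : forall n m x h, 0 <= h -> ~~ odd (n + m) ->
  `|g n (x + h) - \sum_(i < m) g (n + i)%N x * h ^+ i / i`!%:R|
    <= C * M (n + m) * h ^+ m / m`!%:R.
Hypothesis Jdiv : forall A, exists K, A < \sum_(0 <= k < K) (J k.*2.+1)^-1.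

(* J n stands for the J_(n+1) of the header; S k.+1 propagates to S k over a step
   of length at most 1 / (4 * J k.*2.+1). *)
Let S k x := forall n, (n < k.*2)%N -> `|g n x| <= C * 2 ^+ n / 4 ^+ k * M n.

Let M0 n : 0 <= M n. Proof. by apply: prodr_ge0 => i _; exact: ltW. Qed.

Let M_add n i k : (n + i <= k.+1)%N -> M (n + i) <= M n * J k ^+ i.
Proof.
elim: i => [|i IH] nik; first by rewrite addn0 expr0 mulr1.
rewrite addnS /M big_ord_recr/= exprSr mulrA.
rewrite ler_pM//; first exact: M0.
- exact: ltW.
- by apply: IH; rewrite (leq_trans _ nik)// addnS.
- by apply: Jnd; rewrite -ltnS -addnS.
Qed.

Let S_step k x h : S k.+1 x -> 0 <= h -> 4 * h * J k.*2.+1 <= 1 -> S k (x + h).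
Proof.
move=> Sx h0 hJ n nk.
(* With n + m = 2k + 2 the parity condition of [gT] holds, and all functions in the Taylor
   polynomial are controlled by [S k.+1]. *)
pose m := (k.*2.+2 - n)%N.
have nm : (n + m = k.*2.+2)%N.
  by rewrite /m subnKC// (leq_trans (ltnW nk))// -addn2 leq_addr.
have term i : (i <= m)%N -> C * 2 ^+ (n + i) / 4 ^+ k.+1 * M (n + i) * h ^+ i / i`!%:R
    <= C * 2 ^+ n / 4 ^+ k.+1 * M n * 2^-1 ^+ i.
  move=> im; have c0 : 0 <= C * 2 ^+ n / 4 ^+ k.+1.
    by rewrite divr_ge0 ?exprn_ge0// mulr_ge0// exprn_ge0.
  have : M (n + i) <= M n * J k.*2.+1 ^+ i.
    by apply: M_add; rewrite -nm leq_add2l.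
  move=> Mni.
  rewrite (@le_trans _ _ (C * 2 ^+ n / 4 ^+ k.+1 * (M n * (2 * h * J k.*2.+1) ^+ i)))//.
    rewrite ler_pdivrMr ?ltr0n ?fact_gt0//.
    rewrite (@le_trans _ _ (C * 2 ^+ n / 4 ^+ k.+1 * (M n * (2 * h * J k.*2.+1) ^+ i)))//.
      rewrite exprD !exprMn.
      have -> : C * (2 ^+ n * 2 ^+ i) / 4 ^+ k.+1 * M (n + i) * h ^+ i =
        C * 2 ^+ n / 4 ^+ k.+1 * (2 ^+ i * h ^+ i) * M (n + i) by lra.
      have -> : C * 2 ^+ n / 4 ^+ k.+1 * (M n * (2 ^+ i * h ^+ i * J k.*2.+1 ^+ i)) =
        C * 2 ^+ n / 4 ^+ k.+1 * (2 ^+ i * h ^+ i) * (M n * J k.*2.+1 ^+ i) by lra.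
      by rewrite ler_wpM2l// mulr_ge0// mulr_ge0 ?exprn_ge0.
    rewrite ler_peMr ?ler1n ?fact_gt0//.
    by rewrite mulr_ge0// mulr_ge0// exprn_ge0// !mulr_ge0// ltW.
  rewrite -[leRHS]mulrA ler_wpM2l// ler_wpM2l// lerXn2r ?nnegrE ?invr_ge0//.
    by rewrite !mulr_ge0// ltW.
  by move: hJ; lra.
have even_nm : ~~ odd (n + m) by rewrite nm/= negbK odd_double.
have := gT n m x h h0 even_nm; rewrite nm => gnm.
have tri : `|g n (x + h)| <= \sum_(i < m.+1) C * 2 ^+ (n + i) / 4 ^+ k.+1 * M (n + i) * h ^+ i / i`!%:R.
  rewrite big_ord_recr/= nm.
  (* As 2^(2k+2) = 4^(k+1), the Taylor remainder has the form of the term i = m, although [S k.+1]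
     gives no bound for [g] at index 2k + 2. *)
  have -> : C * 2 ^+ k.*2.+2 / 4 ^+ k.+1 = C.
    have -> : (4 : R) = 2 ^+ 2 by lra.
    by rewrite -exprM mul2n doubleS mulfK// expf_neq0.
  rewrite -[g n (x + h)](subrK (\sum_(i < m) g (n + i)%N x * h ^+ i / i`!%:R)) addrC.
  rewrite (le_trans (ler_normD _ _))// lerD// (le_trans (ler_norm_sum _ _ _))//.
  apply: ler_sum => i _; rewrite !normrM (ger0_norm (exprn_ge0 _ h0)) normfV normr_nat.
  rewrite ler_wpM2r ?invr_ge0// ler_wpM2r ?exprn_ge0//.
  by apply: Sx; rewrite doubleS -nm ltn_add2l.
rewrite (le_trans tri)//.
(* The geometric sum costs a factor 2, within the factor 4 gained by passing from level k + 1 to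
   level k. *)
have : \sum_(i < m.+1) C * 2 ^+ n / 4 ^+ k.+1 * M n * 2^-1 ^+ i <= C * 2 ^+ n / 4 ^+ k * M n.
  rewrite -mulr_sumr (@le_trans _ _ (C * 2 ^+ n / 4 ^+ k.+1 * M n * 2))//.
    rewrite ler_wpM2l ?sum_half_le2//.
    by rewrite mulr_ge0// divr_ge0 ?exprn_ge0// mulr_ge0// exprn_ge0.
  rewrite exprS invfM.
  have : 0 <= C * 2 ^+ n / 4 ^+ k * M n.
    by rewrite mulr_ge0// divr_ge0 ?exprn_ge0// mulr_ge0// exprn_ge0.
  by lra.
apply: le_trans; apply: ler_sum => i _; apply: term.
by rewrite -ltnS.
Qed.

(** At 0 every level holds because all [g n] vanish there. Steps of length at most 1 / (4 J (2i+1)),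
    for i from k + d - 1 down to k, then lead to x, each one lowering the level by one. *)
Let S_chain d k x : 0 <= x -> x <= \sum_(k <= i < k + d) (4 * J i.*2.+1)^-1 -> S k x.
Proof.
elim: d k x => [|d IH] k x x0.
  rewrite addn0 big_geq// => x_le0 n _.
  have -> : x = 0 by apply/eqP; rewrite eq_le x_le0.
  rewrite g00 normr0 mulr_ge0// divr_ge0 ?exprn_ge0// mulr_ge0// exprn_ge0//.
rewrite big_ltn ?addnS ?ltnS ?leq_addr// -addSn => xle.
(* The minimum keeps the previous point x - h nonnegative. *)
pose h := Num.min x (4 * J k.*2.+1)^-1.
have hx : h <= x by rewrite ge_min lexx.
have J4 : 0 < 4 * J k.*2.+1 by rewrite mulr_gt0.
have h0 : 0 <= h by rewrite le_min x0/= invr_ge0 ltW.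
rewrite -(subrK h x); apply: S_step => //.
- apply: IH; first by rewrite subr_ge0.
  rewrite /h; case: (leP x (4 * J k.*2.+1)^-1) => _; last by rewrite lerBlDl.
  rewrite subrr sumr_ge0// => i _.
  by rewrite invr_ge0 mulr_ge0// ltW.
- have : h <= (4 * J k.*2.+1)^-1 by rewrite ge_min lexx orbT.
  by rewrite -[_^-1]mul1r ler_pdivlMr//; lra.
Qed.

(** Divergence makes x reachable from every starting level, so [S k x] holds for all positive k and
    |g 0 x| <= C / 4^k. *)
Lemma bang_vanish x : 0 <= x -> g 0 x = 0.
Proof.
move=> x0; have small k : (0 < k)%N -> `|g 0 x| <= C / 4 ^+ k.
  move=> k0.
  (* Adding the first k terms to the threshold leaves more than 4x for the sum from k to K. *)
  have [K HK] := Jdiv (4 * x + \sum_(0 <= i < k) (J i.*2.+1)^-1).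
  have kK : (k <= K)%N.
    rewrite leqNgt; apply/negP => Kk; move: HK.
    rewrite (big_cat_nat (leq0n K) (ltnW Kk))//= ltNge => /negP; apply.
    have : 0 <= \sum_(K <= i < k) (J i.*2.+1)^-1.
      by apply: sumr_ge0 => i _; rewrite invr_ge0 ltW.
    by lra.
  have : S k x.
    apply: (@S_chain (K - k)) => //; rewrite subnKC//.
    move: HK; rewrite (big_cat_nat (leq0n k) kK)//=.
    under [\sum_(k <= i < K) (4 * _)^-1]eq_bigr do rewrite invfM.
    by rewrite -mulr_sumr; lra.
  by move=> /(_ 0%N); rewrite double_gt0 k0 expr0 mulr1 /M big_ord0 mulr1; apply.
apply/eqP; rewrite -normr_le0 leNgt; apply/negP => g_gt0.
have Cg : 0 <= C / `|g 0 x| by rewrite divr_ge0.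
have := archi_boundP Cg; set k := Num.bound _ => Hk.
have := small k.+1 (ltn0Sn k); rewrite ler_pdivlMr ?exprn_gt0//.
rewrite leNgt => /negP; apply.
rewrite mulrC -ltr_pdivrMr// (lt_le_trans Hk)//.
rewrite -natrX ler_nat (leq_trans _ (ltnW (ltn_expl _ _)))//.
Qed.

End bang.

(** * Cosine integrals weighted by powers *)

Section integral_cos.
Context {R : realType} (mu : probability R R).
Implicit Types f g : R -> R.

Lemma integrable_dominated f g : measurable_fun [set: R] f ->
  (forall x, `|f x| <= `|g x|) ->
  mu.-integrable [set: R] (EFin \o g) -> mu.-integrable [set: R] (EFin \o f).
Proof.
move=> mf fg; apply: le_integrable => //; first exact/measurable_EFinP.
by move=> x _ /=; rewrite lee_fin.
Qed.

Lemma measurable_cos_affine (a b : R) :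
  measurable_fun [set: R] (fun x : R => cos (a * x + b)).
Proof.
apply: (@measurableT_comp _ _ _ _ _ _ (@cos R)).
  by apply: continuous_measurable_fun; exact: continuous_cos.
by apply: measurable_funD => //; exact: measurable_funM.
Qed.

Lemma integrable_cos (a b : R) :
  mu.-integrable [set: R] (EFin \o (fun x : R => cos (a * x + b))).
Proof.
apply: (@integrable_dominated _ (cst 1)).
- exact: measurable_cos_affine.
- by move=> x /=; rewrite normr1 cos_max.
- exact: finite_measure_integrable_cst.
Qed.

Lemma Rintegral_sum (I : Type) (s : seq I) (f : I -> R -> R) :
  (forall i, mu.-integrable [set: R] (EFin \o f i)) ->
  mu.-integrable [set: R] (EFin \o (fun x => \sum_(i <- s) f i x)) /\
  \int[mu]_x (\sum_(i <- s) f i x) = \sum_(i <- s) \int[mu]_x f i x.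
Proof.
move=> fi; elim: s => [|i s [IHi IHs]].
  split.
    rewrite (_ : _ \o _ = cst 0%E); first exact: integrable0.
    by apply/funext => x /=; rewrite big_nil.
  rewrite big_nil (@eq_Rintegral _ _ _ _ _ (cst 0)).
    by rewrite Rintegral_cst// mul0r.
  by move=> x _ /=; rewrite big_nil.
have e : (fun x => \sum_(j <- i :: s) f j x) = (fun x => f i x + \sum_(j <- s) f j x).
  by apply/funext => x; rewrite big_cons.
rewrite e; split; first exact: (integrableD _ (fi i) IHi).
by rewrite RintegralD// IHs big_cons.
Qed.

Hypothesis mom : forall k, mu.-integrable [set: R] (fun x => (x ^+ k)%:E).

Lemma integrable_Xcos n (a b : R) :
  mu.-integrable [set: R] (EFin \o (fun x : R => x ^+ n * cos (a * x + b))).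
Proof.
apply: (@integrable_dominated _ (fun x => x ^+ n)) => //.
- by apply: measurable_funM => //; exact: measurable_cos_affine.
- by move=> x /=; rewrite normrM ler_piMr// cos_max.
- exact: mom.
Qed.

Variable s : R.

(** The phase n pi/2 makes this the n-th derivative in t, under the integral sign, of the integral
    of cos(t x + s). *)
Definition Xcos_int n t :=
  \int[mu]_x (x ^+ n * cos (t * x + (s + n%:R * (pi / 2)))).

(** The pointwise bound [cos_taylor] is integrated. Evenness of n + m turns |x|^(n+m) into x^(n+m),
    so that only even moments enter the remainder. *)
Lemma Xcos_int_taylor n m t h : 0 <= h -> ~~ odd (n + m) ->
  `|Xcos_int n (t + h) - \sum_(i < m) Xcos_int (n + i) t * h ^+ i / i`!%:R|
  <= \int[mu]_x (x ^+ (n + m)) * h ^+ m / m`!%:R.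
Proof.
move=> h0 enm.
pose F (i : 'I_m) (x : R) :=
  x ^+ (n + i) * cos (t * x + (s + (n + i)%:R * (pi / 2))) * (h ^+ i / i`!%:R).
have Fi i : mu.-integrable [set: R] (EFin \o F i).
  exact: (integrableZr _ _ (integrable_Xcos _ _ _)).
have [Fs Fe] := Rintegral_sum _ (index_enum 'I_m) F Fi.
have -> : \sum_(i < m) Xcos_int (n + i) t * h ^+ i / i`!%:R =
    \int[mu]_x (\sum_(i < m) F i x).
  rewrite Fe; apply: eq_bigr => i _; rewrite /F RintegralZr//; last first.
    exact: integrable_Xcos.
  by rewrite -[LHS]mulrA.
rewrite /Xcos_int -RintegralB//; last exact: integrable_Xcos.
rewrite -mulrA -RintegralZr//; last exact: mom.
rewrite (le_trans (le_normr_Rintegral _ _))//.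
  exact: (integrableB _ (integrable_Xcos _ _ _) Fs).
apply: le_Rintegral => //.
- apply: integrable_norm; exact: (integrableB _ (integrable_Xcos _ _ _) Fs).
- exact: (integrableZr _ _ (mom _)).
move=> x _.
have := @cos_taylor R m (t * x + (s + n%:R * (pi / 2))) x h h0.
have -> : x ^+ n * cos ((t + h) * x + (s + n%:R * (pi / 2))) - \sum_(i < m) F i x =
  x ^+ n * (cos (t * x + (s + n%:R * (pi / 2)) + h * x) -
   \sum_(i < m) cos (t * x + (s + n%:R * (pi / 2)) + i%:R * (pi / 2)) * (h * x) ^+ i / i`!%:R).
  rewrite mulrBr; congr (_ * cos _ - _); first by lra.
  rewrite mulr_sumr; apply: eq_bigr => i _; rewrite /F exprD exprMn.
  rewrite (_ : t * x + (s + (n + i)%:R * (pi / 2)) = t * x + (s + n%:R * (pi / 2)) + i%:R * (pi / 2)).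
    by set c := cos _; ring.
  by rewrite natrD; ring.
move=> H; rewrite normrM (le_trans (ler_wpM2l (normr_ge0 _) H))//.
rewrite normrX le_eqVlt; apply/orP; left; apply/eqP.
have <- : `|x| ^+ (n + m) = x ^+ (n + m) by rewrite -normrX ger0_norm// exprn_even_ge0.
by rewrite exprMn exprD; ring.
Qed.

Lemma Xcos_int0 n : Xcos_int n 0 = cos (s + n%:R * (pi / 2)) * \int[mu]_x (x ^+ n).
Proof.
rewrite /Xcos_int [RHS]mulrC -RintegralZr//; last exact: mom.
by apply: eq_Rintegral => x _; rewrite mul0r add0r.
Qed.

End integral_cos.

(** Moments are compared only after multiplication by cos(s + n pi/2), their weight at t = 0. This
    form serves both equality of all moments with any s and equality of the even ones with s = 0. *)
Lemma cos_integrals_eq (R : realType) (mu nu : probability R R) (J : nat -> R) (C s : R) :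
  (forall k, mu.-integrable [set: R] (fun x => (x ^+ k)%:E)) ->
  (forall k, nu.-integrable [set: R] (fun x => (x ^+ k)%:E)) ->
  0 <= C -> (forall n, 0 < J n) -> (forall m n, (m <= n)%N -> J m <= J n) ->
  (forall A, exists K, A < \sum_(0 <= k < K) (J k.*2.+1)^-1) ->
  (forall k, \int[mu]_x (x ^+ k.*2) <= C * \prod_(i < k.*2) J i) ->
  (forall k, \int[nu]_x (x ^+ k.*2) <= C * \prod_(i < k.*2) J i) ->
  (forall n, cos (s + n%:R * (pi / 2)) * \int[mu]_x (x ^+ n) =
             cos (s + n%:R * (pi / 2)) * \int[nu]_x (x ^+ n)) ->
  forall t, 0 <= t -> \int[mu]_x cos (t * x + s) = \int[nu]_x cos (t * x + s).
Proof.
move=> mi ni C0 J0 Jnd Jdiv mC nC eqm t t0; apply/eqP; rewrite -subr_eq0; apply/eqP.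
pose g n t := Xcos_int mu s n t - Xcos_int nu s n t.
have -> : \int[mu]_x cos (t * x + s) - \int[nu]_x cos (t * x + s) = g 0%N t.
  by congr (_ - _); apply: eq_Rintegral => x _; rewrite expr0 mul1r mul0r addr0.
apply: (@bang_vanish R g J (2 * C)) => //.
- by rewrite mulr_ge0.
- by move=> n; rewrite /g !Xcos_int0// eqm subrr.
move=> n m x h h0 enm; rewrite /g.
have -> : Xcos_int mu s n (x + h) - Xcos_int nu s n (x + h) -
   \sum_(i < m) (Xcos_int mu s (n + i) x - Xcos_int nu s (n + i) x) * h ^+ i / i`!%:R =
  (Xcos_int mu s n (x + h) - \sum_(i < m) Xcos_int mu s (n + i) x * h ^+ i / i`!%:R) -
  (Xcos_int nu s n (x + h) - \sum_(i < m) Xcos_int nu s (n + i) x * h ^+ i / i`!%:R).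
  under eq_bigr do rewrite !mulrBl.
  by rewrite sumrB; ring.
rewrite (le_trans (ler_normB _ _))//.
rewrite (le_trans (lerD (Xcos_int_taylor mu mi s n m x h h0 enm) (Xcos_int_taylor nu ni s n m x h h0 enm)))//.
rewrite -!mulrA -mulrDl [leRHS]mulrA [leRHS]mulrA ler_wpM2r ?divr_ge0 ?exprn_ge0//.
have [k ->] : exists k, (n + m)%N = k.*2 by exists (n + m)./2; rewrite even_halfK.
by rewrite (le_trans (lerD (mC k) (nC k)))// -mulrA; lra.
Qed.

(** * Kernels built from powers of cosines *)

Lemma bernoulli_inv (R : realType) (z : R) (N : nat) : 0 <= z -> z <= 1 ->
  (1 - z) ^+ N * (1 + N%:R * z) <= 1.
Proof.
move=> z0 z1; elim: N => [|N IH]; first by rewrite expr0 mul0r addr0 mulr1.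
rewrite (le_trans _ IH)// exprSr -mulrA ler_wpM2l ?exprn_ge0 ?subr_ge0//.
rewrite -natr1.
have : 0 <= (N%:R + 1) * (z * z) by rewrite !mulr_ge0// addr_ge0.
by lra.
Qed.

(** The Taylor bound of order 3 gives |cos y - 1 + y^2/2| <= |y|^3/6 <= y^2/6 for |y| <= 1. *)
Lemma cos_quadratic (R : realType) (y : R) : `|y| <= 1 -> 0 <= cos y <= 1 - y ^+ 2 / 3.
Proof.
move=> y1; have := @cos_taylor R 3 0 y 1 ler01.
rewrite !big_ord_recr big_ord0/= !mul1r !mul0r !add0r cos0 cos_pihalf.
have -> : 2 * (pi / 2) = pi :> R by rewrite mulrC divfK.
rewrite cospi expr0 fact0.
rewrite (_ : 2`! = 2)%N// (_ : 3`! = 6)%N//.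
have : `|y| ^+ 3 <= y ^+ 2.
  by rewrite exprS -normrX (ger0_norm (sqr_ge0 y)) ler_piMl// sqr_ge0.
have : y ^+ 2 <= 1.
  by rewrite -[y ^+ 2]ger0_norm ?sqr_ge0// normrX exprn_ile1.
rewrite ler_norml => h1 h2 /andP[h3 h4].
by apply/andP; split; lra.
Qed.

(** The scaling pushes the other maxima of |cos| to infinity. The cubic exponent forces decay, since
    (n+1)^3 (y/(n+1))^2 is unbounded for nonzero y; a quadratic exponent would give a Gaussian
    limit. *)
Definition cos_kernel (R : realType) (n : nat) (y : R) : R :=
  cos (y / n.+1%:R) ^+ (n.+1 ^ 3).

Lemma cos_kernel_cvg (R : realType) (y : R) :
  (fun n => cos_kernel R n y) @ \oo --> ((y == 0)%:R : R).
Proof.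
have [->|y0] := eqVneq y 0.
  rewrite (_ : (fun n => _) = cst 1); first exact: cvg_cst.
  by apply/funext => n; rewrite /cos_kernel mul0r cos0 expr1n.
rewrite /=; have y2 : 0 < y ^+ 2 by rewrite exprn_even_gt0.
have bound : forall n : nat, `|y| <= n.+1%:R ->
    0 <= cos_kernel R n y <= (3 / y ^+ 2) * harmonic n.
  move=> n yn; rewrite /cos_kernel /harmonic.
  set m : R := n.+1%:R; have m0 : 0 < m by rewrite ltr0n.
  have ym : `|y / m| <= 1 by rewrite normrM normfV (ger0_norm (ltW m0)) ler_pdivrMr// mul1r.
  have /andP[c0 c1] := cos_quadratic R (y / m) ym.
  rewrite exprn_ge0//=.
  (* The kernel is at most (1 - z)^(m^3) by [cos_quadratic], and m^3 z = m y^2 / 3, so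
     [bernoulli_inv] yields the bound 3 / (m y^2). *)
  pose z := (y / m) ^+ 2 / 3.
  have z0 : 0 <= z by rewrite divr_ge0// sqr_ge0.
  have z1 : z <= 1.
    have : (y / m) ^+ 2 <= 1 by rewrite -[_ ^+ 2]ger0_norm ?sqr_ge0// normrX exprn_ile1.
    by move=> ym2; rewrite /z ler_pdivrMr// mul1r (le_trans ym2)// ler1n.
  rewrite (@le_trans _ _ ((1 - z) ^+ (n.+1 ^ 3)))//.
    by rewrite lerXn2r ?nnegrE// subr_ge0.
  have := bernoulli_inv R z (n.+1 ^ 3) z0 z1.
  have -> : (n.+1 ^ 3)%:R * z = m * y ^+ 2 / 3.
    by rewrite natrX -/m /z; field; rewrite gt_eqF.
  have my : 0 < m * y ^+ 2 / 3 by rewrite divr_gt0// mulr_gt0.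
  have -> : 3 / y ^+ 2 * m^-1 = (m * y ^+ 2 / 3)^-1.
    by field; rewrite y0 gt_eqF.
  move=> bern; rewrite -[leRHS]mul1r ler_pdivlMr//; apply: le_trans bern.
  by rewrite ler_wpM2l ?exprn_ge0 ?subr_ge0// lerDr.
apply: (@squeeze_cvgr _ _ _ _ (cst 0) (fun n => (3 / y ^+ 2) * harmonic n)).
- near=> n; apply: bound.
  near: n; exists (Num.bound `|y|) => // n /= hn.
  rewrite (le_trans (ltW (archi_boundP (normr_ge0 y))))// ler_nat.
  by rewrite (leq_trans hn).
- exact: cvg_cst.
- rewrite -[X in _ --> X](mulr0 (3 / y ^+ 2)); apply: cvgMr.
  exact: cvg_harmonic.
Unshelve. all: by end_near. Qed.

Lemma cos_kernel_le1 (R : realType) (n : nat) (y : R) : `|cos_kernel R n y| <= 1.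
Proof. by rewrite normrX exprn_ile1// cos_max. Qed.

(* Q stands for integrating to the same value under two measures, possibly
   after symmetrization. *)
Section trigonometric_polynomials.
Context {R : realType} (Q : (R -> R) -> Prop).
Hypothesis QD : forall f g, Q f -> Q g -> Q (fun x => f x + g x).
Hypothesis QZ : forall c f, Q f -> Q (fun x => c * f x).
Hypothesis Qcos : forall t s, Q (fun x => cos (t * x + s)).

(** The product-to-sum formula trades one cosine factor for shifted frequencies and phases, hence
    the extra factor cos(t x + s) in the induction. *)
Lemma Q_cosM N u v t s : Q (fun x => cos (t * x + s) * cos (u * x + v) ^+ N).
Proof.
elim: N t s => [|N IH] t s.
  by rewrite (_ : (fun x => _) = (fun x => cos (t * x + s)))//; apply/funext => x; rewrite mulr1.
have -> : (fun x => cos (t * x + s) * cos (u * x + v) ^+ N.+1) =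
  (fun x => 2^-1 * (cos ((t + u) * x + (s + v)) * cos (u * x + v) ^+ N +
                    cos ((t - u) * x + (s - v)) * cos (u * x + v) ^+ N)).
  apply/funext => x; rewrite exprS.
  have -> : (t + u) * x + (s + v) = (t * x + s) + (u * x + v) by lra.
  have -> : (t - u) * x + (s - v) = (t * x + s) - (u * x + v) by lra.
  by move: (t * x + s) (u * x + v) => a b; rewrite cosD cosB; field.
by apply: QZ; apply: QD; exact: IH.
Qed.

Lemma Q_cos_kernel n c : Q (fun x => cos_kernel R n (x - c)).
Proof.
have := Q_cosM (n.+1 ^ 3) (n.+1%:R^-1) (- c / n.+1%:R) 0 0.
congr (Q _); apply/funext => x; rewrite mul0r addr0 cos0 mul1r /cos_kernel.
by congr (cos _ ^+ _); move: (n.+1%:R^-1) => m; ring.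
Qed.

End trigonometric_polynomials.

(** * Atoms recovered from trigonometric integrals *)

Section atoms.
Context {R : realType}.

Lemma measurable_cos_kernel (n : nat) (c : R) :
  measurable_fun [set: R] (fun x : R => cos_kernel R n (x - c)).
Proof.
apply: (eq_measurable_fun (fun x : R => cos (n.+1%:R^-1 * x + (- c / n.+1%:R)) ^+ (n.+1 ^ 3))).
  by move=> x _; rewrite /cos_kernel; congr (cos _ ^+ _); move: (n.+1%:R^-1) => m; ring.
by apply: measurable_funX; exact: measurable_cos_affine.
Qed.

Lemma integrable_cos_kernel (mu : probability R R) (n : nat) (c : R) :
  mu.-integrable [set: R] (EFin \o (fun x : R => cos_kernel R n (x - c))).
Proof.
apply: (@integrable_dominated _ _ _ (cst 1)).
- exact: measurable_cos_kernel.
- by move=> x /=; rewrite normr1 cos_kernel_le1.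
- exact: finite_measure_integrable_cst.
Qed.

(** Dominated convergence, with the constant 1 as dominating function. *)
Lemma cos_kernel_atom (mu : probability R R) (c : R) :
  (fun n => \int[mu]_x cos_kernel R n (x - c)) @ \oo --> fine (mu [set c]).
Proof.
have mc : measurable [set c] by exact: measurable_set1.
have mf : measurable_fun [set: R] (EFin \o \1_[set c] : R -> \bar R).
  by apply/measurable_EFinP; exact: measurable_indic.
have mK n : measurable_fun [set: R] (fun x : R => (cos_kernel R n (x - c))%:E).
  by apply/measurable_EFinP; exact: measurable_cos_kernel.
have [||//|_ _] := @dominated_convergence _ R R mu setT measurableT
  (fun n x => (cos_kernel R n (x - c))%:E) (EFin \o \1_[set c]) (cst 1%E) mK mf.
- apply: aeW => x _ /=; apply: cvg_EFin; first by apply: nearW.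
  rewrite indicE in_set1 -subr_eq0; exact: cos_kernel_cvg.
- exact: (finite_measure_integrable_cst mu 1).
- by apply: aeW => x n _ /=; rewrite lee_fin cos_kernel_le1.
rewrite integral_indic// setIT => H.
by apply: fine_cvg; rewrite fineK ?fin_num_measure.
Qed.

End atoms.

Section determinacy.
Context {R : realType}.
Variables (mu nu : probability R R) (J : nat -> R) (C : R).
Hypothesis mi : forall k, mu.-integrable [set: R] (fun x => (x ^+ k)%:E).
Hypothesis ni : forall k, nu.-integrable [set: R] (fun x => (x ^+ k)%:E).
Hypothesis C0 : 0 <= C.
Hypothesis J0 : forall n, 0 < J n.
Hypothesis Jnd : forall m n, (m <= n)%N -> J m <= J n.
Hypothesis Jdiv : forall A, exists K, A < \sum_(0 <= k < K) (J k.*2.+1)^-1.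
Hypothesis muC : forall k, \int[mu]_x (x ^+ k.*2) <= C * \prod_(i < k.*2) J i.
Hypothesis even_eq : forall k, \int[mu]_x (x ^+ k.*2) = \int[nu]_x (x ^+ k.*2).

Lemma atoms_eq : (forall k, \int[mu]_x (x ^+ k) = \int[nu]_x (x ^+ k)) ->
  forall c : R, mu [set c] = nu [set c].
Proof.
move=> eqm c.
have nuC k : \int[nu]_x (x ^+ k.*2) <= C * \prod_(i < k.*2) J i by rewrite -even_eq.
pose Q f := mu.-integrable [set: R] (EFin \o f) /\ nu.-integrable [set: R] (EFin \o f) /\
  \int[mu]_x f x = \int[nu]_x f x.
have Qpos t s : 0 <= t -> Q (fun x => cos (t * x + s)).
  move=> t0; split; [exact: integrable_cos|split; first exact: integrable_cos].
  apply: (@cos_integrals_eq R mu nu J C) => //.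
  by move=> n; rewrite eqm.
have Qcos t s : Q (fun x => cos (t * x + s)).
  have [|t0] := leP 0 t; first exact: Qpos.
  rewrite (_ : (fun x => _) = (fun x => cos (- t * x + - s))).
    by apply: Qpos; rewrite oppr_ge0 ltW.
  by apply/funext => x; rewrite -cosN; congr cos; ring.
have QD f g : Q f -> Q g -> Q (fun x => f x + g x).
  move=> [f1 [f2 ef]] [g1 [g2 eg]]; split; first exact: (integrableD _ f1 g1).
  by split; [exact: (integrableD _ f2 g2)|rewrite (RintegralD measurableT f1 g1) (RintegralD measurableT f2 g2) ef eg].
have QZ a f : Q f -> Q (fun x => a * f x).
  move=> [f1 [f2 ef]]; split; first exact: (integrableZl _ a f1).
  by split; [exact: (integrableZl _ a f2)|rewrite (RintegralZl _ measurableT f1) (RintegralZl _ measurableT f2) ef].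
have K n : \int[mu]_x cos_kernel R n (x - c) = \int[nu]_x cos_kernel R n (x - c).
  by have [_ [_]] := Q_cos_kernel Q QD QZ Qcos n c.
rewrite -[LHS]fineK ?fin_num_measure// -[RHS]fineK ?fin_num_measure//; congr EFin.
have := cos_kernel_atom mu c; rewrite (funext K) => Kmu.
exact: (cvg_unique _ Kmu (cos_kernel_atom nu c)).
Qed.

(** With even moments alone, only the integrals of cos(t x) are known to agree, so the kernel
    argument is run on the symmetrizations f(x) + f(-x). *)
Lemma sym_atoms_eq (c : R) :
  (mu [set c] + mu [set (- c)%R] = nu [set c] + nu [set (- c)%R])%E.
Proof.
have nuC k : \int[nu]_x (x ^+ k.*2) <= C * \prod_(i < k.*2) J i by rewrite -even_eq.
have cos_odd n : odd n -> cos (n%:R * (pi / 2)) = 0 :> R.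
  move=> on; rewrite -(odd_double_half n) on add1n; elim: n./2 => [|k IH].
    by rewrite mul1r cos_pihalf.
  rewrite doubleS (_ : _ * _ = k.*2.+1%:R * (pi / 2) + pi); last by rewrite -addn2 natrD; field.
  by rewrite cosDpi IH oppr0.
have base t : 0 <= t -> \int[mu]_x cos (t * x) = \int[nu]_x cos (t * x).
  move=> t0.
  have ext (m : probability R R) : \int[m]_x cos (t * x) = \int[m]_x cos (t * x + 0).
    by apply: eq_Rintegral => x _; rewrite addr0.
  rewrite !ext; apply: (@cos_integrals_eq R mu nu J C 0) => //.
  move=> n; rewrite add0r; have [/cos_odd ->|en] := boolP (odd n).
    by rewrite !mul0r.
  by rewrite -(even_halfK en) even_eq.
pose S (f : R -> R) x := f x + f (- x).
pose Q f := mu.-integrable [set: R] (EFin \o S f) /\ nu.-integrable [set: R] (EFin \o S f) /\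
  \int[mu]_x S f x = \int[nu]_x S f x.
have base' t : \int[mu]_x cos (t * x) = \int[nu]_x cos (t * x).
  have [|t0] := leP 0 t; first exact: base.
  under eq_Rintegral do rewrite -cosN -mulNr.
  under [RHS]eq_Rintegral do rewrite -cosN -mulNr.
  by apply: base; rewrite oppr_ge0 ltW.
have integrable_cos0 (m : probability R R) t :
    m.-integrable [set: R] (EFin \o (fun x => cos (t * x))).
  have := @integrable_cos R m t 0.
  by congr (integrable _ _ (EFin \o _)); apply/funext => x; rewrite addr0.
(* Symmetrization removes the sine part: cos(t x + s) becomes 2 cos(s) cos(t x). *)
have Qcos t s : Q (fun x => cos (t * x + s)).
  rewrite /Q (_ : S _ = (fun x => 2 * cos s * cos (t * x))); last first.
    apply/funext => x; rewrite /S mulrN [- _ + s]addrC cosB addrC [t * x + s]addrC cosD.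
    by ring.
  split; first exact: (integrableZl _ _ (integrable_cos0 _ t)).
  split; first exact: (integrableZl _ _ (integrable_cos0 _ t)).
  rewrite (RintegralZl _ measurableT (integrable_cos0 mu t)).
  by rewrite (RintegralZl _ measurableT (integrable_cos0 nu t)) base'.
have QD f g : Q f -> Q g -> Q (fun x => f x + g x).
  move=> [f1 [f2 ef]] [g1 [g2 eg]].
  rewrite /Q (_ : S _ = fun x => S f x + S g x); last first.
    by apply/funext => x; rewrite /S addrACA.
  split; first exact: (integrableD _ f1 g1).
  by split; [exact: (integrableD _ f2 g2)|rewrite (RintegralD measurableT f1 g1) (RintegralD measurableT f2 g2) ef eg].
have QZ a f : Q f -> Q (fun x => a * f x).
  move=> [f1 [f2 ef]].
  rewrite /Q (_ : S _ = fun x => a * S f x); last first.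
    by apply/funext => x; rewrite /S mulrDr.
  split; first exact: (integrableZl _ a f1).
  by split; [exact: (integrableZl _ a f2)|rewrite (RintegralZl _ measurableT f1) (RintegralZl _ measurableT f2) ef].
have Kr n x : cos_kernel R n (- x - c) = cos_kernel R n (x - - c).
  by rewrite /cos_kernel opprK -opprD mulNr cosN.
have K n : \int[mu]_x cos_kernel R n (x - c) + \int[mu]_x cos_kernel R n (x - - c) =
    \int[nu]_x cos_kernel R n (x - c) + \int[nu]_x cos_kernel R n (x - - c).
  have [_ [_]] := Q_cos_kernel Q QD QZ Qcos n c.
  rewrite -!RintegralD//; try exact: integrable_cos_kernel.
  rewrite /S => e; under eq_Rintegral do rewrite -Kr.
  by under [RHS]eq_Rintegral do rewrite -Kr.
have lim (m : probability R R) :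
   (fun n => \int[m]_x cos_kernel R n (x - c) + \int[m]_x cos_kernel R n (x - - c))
   @ \oo --> fine (m [set c]) + fine (m [set - c]).
  by apply: cvgD; exact: cos_kernel_atom.
rewrite -(fineK (fin_num_measure mu _ (measurable_set1 c)))
  -(fineK (fin_num_measure mu _ (measurable_set1 (- c))))
  -(fineK (fin_num_measure nu _ (measurable_set1 c)))
  -(fineK (fin_num_measure nu _ (measurable_set1 (- c)))) -!EFinD; congr EFin.
have := lim mu; rewrite (funext K) => Kmu.
exact: (cvg_unique _ Kmu (lim nu)).
Qed.

(** For c > 0 the atom at -c is null; for c = 0 the symmetrized identity counts the same atom
    twice. *)
Lemma nonneg_atoms_eq : (forall c : R, c < 0 -> mu [set c] = 0%E) ->
  (forall c : R, c < 0 -> nu [set c] = 0%E) ->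
  forall c : R, 0 <= c -> mu [set c] = nu [set c].
Proof.
move=> mu0 nu0 c; have := sym_atoms_eq c.
rewrite le_eqVlt => H /orP[/eqP c0|c_gt0]; last first.
  by move: H; rewrite (mu0 (- c)) ?oppr_lt0// (nu0 (- c)) ?oppr_lt0// !adde0.
move: H; rewrite -c0 oppr0.
have mf : mu [set 0 : R] \is a fin_num by apply: fin_num_measure; exact: measurable_set1.
have nf : nu [set 0 : R] \is a fin_num by apply: fin_num_measure; exact: measurable_set1.
rewrite -(fineK mf) -(fineK nf) -!EFinD => -[] e; congr EFin.
by lra.
Qed.

End determinacy.

(** * Measures carried by a countable set *)

Lemma probability_setI d (T : measurableType d) (R : realType) (m : probability T R)
    (A S : set T) : measurable A -> measurable S -> m S = 1%E -> m A = m (A `&` S).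
Proof.
move=> mA mS m1; have m0 : m (A `\` S) = 0%E.
  apply: (@subset_measure0 _ _ _ m _ (~` S)).
  - exact: measurableD.
  - exact: measurableC.
  - by move=> x [].
  - by apply: etrans (probability_setC m mS) _; rewrite m1 subee.
by apply: etrans (measureDI m mA mS) _; rewrite -[RHS]add0e; congr (_ + _)%E.
Qed.

Arguments probability_setI {d T R} m {A S}.

(** Full mass of the range is assumed for [mu] only: equal atoms transfer it to [nu]. Repetitions in
    [x_] are allowed, which is why the pieces are made disjoint with [seqDU]; each piece is empty or
    a singleton. *)
Lemma measure_eq_of_atoms (R : realType) (mu nu : probability R R) (x_ : nat -> R) :
  (forall n, mu [set x_ n] = nu [set x_ n]) -> mu (range x_) = 1%E ->
  forall A, measurable A -> mu A = nu A.
Proof.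
move=> eq_at mu1 A mA.
have mr : measurable (range x_) by apply: countable_measurable => //; exact: (sub_countable (card_image_le x_ setT)).
have eqs B : measurable B -> mu (B `&` range x_) = nu (B `&` range x_).
  move=> mB.
  pose F n := B `&` [set x_ n].
  have -> : B `&` range x_ = \bigcup_n (seqDU F n).
    rewrite -seqDU_bigcup_eq; apply/seteqP; split => [x [Bx [n _ xn]]|x [n _ [Bx xn]]].
      by exists n.
    by split => //; exists n.
  have mF n : measurable (F n) by apply: measurableI.
  have mD n : measurable (seqDU F n).
    by apply: measurableD => //; apply: bigsetU_measurable.
  rewrite !measure_bigcup//; try exact: trivIset_seqDU.
  apply: eq_eseriesr => n _.
  have : seqDU F n `<=` [set x_ n].
    by move=> x [[]].
  by move=> /classical_sets.subset_set1[->|->]; [rewrite !measure0|exact: eq_at].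
have nu1 : nu (range x_) = 1%E by rewrite -[range x_]setTI -eqs// setTI.
rewrite (probability_setI mu mA mr mu1) (probability_setI nu mA mr nu1).
exact: eqs.
Qed.

(** * First-passage indices and divergence of their inverses *)

(** Telescoping with 1/j^2 <= 1/(j-1) - 1/j bounds the sum by 1/(a-1), which is at most 2/a for a >=
    2. *)
Lemma sum_inv_sqr_le (R : realType) (a N : nat) : (2 <= a)%N ->
  \sum_(a <= j < N) ((j%:R : R) ^+ 2)^-1 <= 2 / a%:R.
Proof.
move=> a2.
have tel : \sum_(a <= j < N) ((j%:R : R) ^+ 2)^-1 <= (a.-1%:R)^-1.
  have [Na|aN] := leqP N a; first by rewrite big_geq// invr_ge0.
  suff : \sum_(a <= j < N) ((j%:R : R) ^+ 2)^-1 <= (a.-1%:R)^-1 - (N.-1%:R)^-1.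
    by move=> /le_trans; apply; rewrite gerBl invr_ge0.
  elim: N aN => // N IH; rewrite ltnS leq_eqVlt => /orP[/eqP <-|aN].
    rewrite big_nat1; case: a a2 {IH} => // a a1 /=.
    have : 0 < a%:R :> R by rewrite ltr0n.
    rewrite -natr1; move: (a%:R) => x x0.
    rewrite (_ : x^-1 - (x + 1)^-1 = (x * (x + 1))^-1); last by field; rewrite !gt_eqF// addr_gt0.
    rewrite lef_pV2 ?posrE ?mulr_gt0 ?exprn_gt0 ?addr_gt0//.
    by rewrite expr2 ler_wpM2r ?lerDl// addr_ge0// ltW.
  rewrite big_nat_recr/=; last by rewrite ltnW.
  have := IH aN.
  have : ((N%:R : R) ^+ 2)^-1 <= (N.-1%:R)^-1 - (N%:R)^-1.
    case: N aN {IH} => // N aN /=.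
    have : 0 < N%:R :> R by rewrite ltr0n (leq_trans (ltnW a2)).
    rewrite -natr1; move: (N%:R) => x x0.
    rewrite (_ : x^-1 - (x + 1)^-1 = (x * (x + 1))^-1); last by field; rewrite !gt_eqF// addr_gt0.
    rewrite lef_pV2 ?posrE ?mulr_gt0 ?exprn_gt0 ?addr_gt0//.
    by rewrite expr2 ler_wpM2r ?lerDl// addr_ge0// ltW.
  by lra.
rewrite (le_trans tel)//.
case: a a2 {tel} => // a a1 /=.
have : 1 <= a%:R :> R by rewrite ler1n.
rewrite -[a.+1%:R]natr1; move: (a%:R) => x x1.
have x0 : 0 < x by lra.
by rewrite ler_pdivlMr ?addr_gt0// mulrC ler_pdivrMr//; lra.
Qed.

Section first_passage.
Context {R : realType} (q : nat -> R) (j0 : nat).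
Hypothesis j0_ge2 : (2 <= j0)%N.
Hypothesis q_mono : forall i j : nat, (j0 <= i)%N -> (i <= j)%N -> q i <= q j.
Hypothesis q_lim : q @ \oo --> +oo.

Lemma passage_ex (n : nat) : exists j, (j0 <= j)%N && (n.+2%:R <= q j).
Proof.
have /cvgryPge/(_ n.+2%:R)[N _ HN] := q_lim.
by exists (maxn j0 N); rewrite leq_maxl/= HN//= leq_maxr.
Qed.

(** These are the J_n; the offset 2 in the threshold n + 2 leaves a summable factor j^(-2) in the
    moment of order n. *)
Definition passage n := ex_minn (passage_ex n).

Lemma passage_ge n : (j0 <= passage n)%N.
Proof. by rewrite /passage; case: ex_minnP => j /andP[]. Qed.

Lemma passage_le n j : (j0 <= j)%N -> n.+2%:R <= q j -> (passage n <= j)%N.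
Proof. by move=> jj qj; rewrite /passage; case: ex_minnP => k _; apply; rewrite jj. Qed.

Lemma q_passage n j : (passage n <= j)%N -> n.+2%:R <= q j.
Proof.
rewrite /passage; case: ex_minnP => k /andP[k0 qk] _ kj.
by rewrite (le_trans qk)// q_mono.
Qed.

Lemma passage_mono m n : (m <= n)%N -> (passage m <= passage n)%N.
Proof.
move=> mn; apply: passage_le; first exact: passage_ge.
by rewrite (@le_trans _ _ n.+2%:R) ?ler_nat ?ltnS// q_passage.
Qed.

Lemma passage_gt0 n : (0 < passage n)%N.
Proof. by rewrite (leq_trans _ (passage_ge n))// (leq_trans _ j0_ge2). Qed.

Definition passage_prod n : R := \prod_(i < n) (passage i.+1)%:R.

Lemma passage_prod_ge1 n : 1 <= passage_prod n.
Proof.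
rewrite /passage_prod; apply: (big_ind (fun x => 1 <= x)) => // [x y|i _].
  exact: mulr_ege1.
by rewrite ler1n passage_gt0.
Qed.

(** If the first c of the indices J_(2k+2) are at most j and the next one is not, then j < J_(2c+2),
    so q j < 2c + 4. *)
Lemma q_count K j : (j0 <= j)%N -> (j < passage K.*2.+2)%N ->
  q j <= 4 + 2 * \sum_(0 <= k < K) (passage k.*2.+2 <= j)%N%:R.
Proof.
elim: K => [|K IH] jj jK.
  rewrite big_geq// mulr0 addr0 leNgt; apply/negP => /ltW qj.
  by move: jK; rewrite ltnNge passage_le.
have [Kj|jK'] := leqP (passage K.*2.+2) j.
  rewrite (eq_big_nat _ _ (F2 := fun=> 1)); last first.
    move=> k /andP[_]; rewrite ltnS => kK.
    by rewrite (leq_trans _ Kj)// passage_mono// !ltnS leq_double.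
  rewrite sumr_const_nat subn0.
  have -> : 4 + 2 * K.+1%:R = K.+1.*2.+2.+2%:R :> R.
    by rewrite -muln2 -!natr1 natrM -natr1; lra.
  rewrite leNgt; apply/negP => /ltW qj.
  by move: jK; rewrite ltnNge passage_le.
by rewrite big_nat_recr//= leqNgt jK'/= addr0 IH.
Qed.

(** Insert [q_count] and exchange the sums: the constant 4 contributes at most 8 / j0 <= 4, and each
    k contributes at most 2 * 2 / J_(2k+2). *)
Lemma passage_inv_diverges :
  (forall A, exists N, A < \sum_(j0 <= j < N) q j / (j%:R) ^+ 2) ->
  forall A, exists K, A < \sum_(0 <= k < K) ((passage k.*2.+2)%:R : R)^-1.
Proof.
move=> qdiv A; have [N HN] := qdiv (4 + 4 * A).
have [K NK] : exists K, (N <= passage K.*2.+2)%N.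
  have [->|N0] := eqVneq N 0%N; first by exists 0%N.
  (* If J_(2K+2) were below N, then q at max(j0, N) would be at least 2K + 4, against the choice of
     K. *)
  exists (Num.bound `|q (maxn j0 N)|).
  set K := Num.bound _; rewrite leqNgt; apply/negP => KN.
  have := q_passage K.*2.+2 (maxn j0 N) _.
  rewrite leq_max (ltnW KN) orbT => /(_ isT); apply/negP; rewrite -ltNge.
  rewrite (le_lt_trans (ler_norm _))// (lt_le_trans (archi_boundP _))//.
  by rewrite ler_nat -/K -addnn -!addSn leq_addl.
exists K.
have bnd : \sum_(j0 <= j < N) q j / (j%:R) ^+ 2 <=
    4 + 4 * \sum_(0 <= k < K) ((passage k.*2.+2)%:R : R)^-1.
  have pos (j : nat) : 0 <= ((j%:R : R) ^+ 2)^-1 by rewrite invr_ge0 exprn_ge0.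
  apply: (@le_trans _ _ (\sum_(j0 <= j < N)
      (4 / (j%:R) ^+ 2 + 2 * \sum_(0 <= k < K) (passage k.*2.+2 <= j)%N%:R / (j%:R) ^+ 2))).
    rewrite big_nat [leRHS]big_nat; apply: ler_sum => j /andP[jj jN].
    rewrite -mulr_suml mulrA -mulrDl ler_wpM2r//.
    by apply: q_count => //; exact: leq_trans NK.
  rewrite big_split/= lerD//.
    rewrite -mulr_sumr -[leRHS]mulr1 ler_wpM2l//.
    rewrite (le_trans (sum_inv_sqr_le R _ _ j0_ge2))//.
    by rewrite ler_pdivrMr ?mul1r ?ler_nat// ltr0n (leq_trans _ j0_ge2).
  rewrite -mulr_sumr exchange_big/= (_ : 4 = 2 * 2); last by lra.
  rewrite -mulrA ler_wpM2l// mulr_sumr; apply: ler_sum => k _.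
  have JK := passage_ge k.*2.+2.
  rewrite (@le_trans _ _ (\sum_(passage k.*2.+2 <= j < N) ((j%:R : R) ^+ 2)^-1))//; last first.
    by apply: sum_inv_sqr_le; exact: leq_trans JK.
  rewrite [leRHS](big_nat_widenl _ j0)//= [leRHS]big_mkcond/=.
  by apply: ler_sum => j _; case: leqP => _; rewrite ?mul1r ?mul0r.
by move: HN bnd; lra.
Qed.

End first_passage.

(** * Bound on the absolute moments *)

Section moment_bound.
Context {R : realType} (pn : nat -> R) (j0 : nat).
Let q j := - ln (pn j) / ln j%:R.
Hypothesis j0_ge2 : (2 <= j0)%N.
Hypothesis pn_gt0 : forall j, 0 < pn j.
Hypothesis q_mono : forall i j : nat, (j0 <= i)%N -> (i <= j)%N -> q i <= q j.
Hypothesis q_lim : q @ \oo --> +oo.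
Let J n := passage q j0 q_lim n.
Let M n := passage_prod q j0 q_lim n.

Lemma expn_mass_le1 (j m : nat) : (2 <= j)%N -> m%:R <= q j -> j%:R ^+ m * pn j <= 1.
Proof.
move=> j2; have lnj : 0 < ln (j%:R : R) by rewrite ln_gt0// ltr1n.
have jpos : 0 < j%:R :> R by rewrite ltr0n (leq_trans _ j2).
rewrite /q ler_pdivlMr// => H.
rewrite -ler_ln ?posrE ?mulr_gt0 ?exprn_gt0//.
rewrite lnM ?posrE ?exprn_gt0// lnXn// ln1 -[ln _ *+ _]mulr_natl; lra.
Qed.

(** In the induction, if J_(n+1) <= j then q j >= n + 3 and the product is at most 1; otherwise the
    new factor j is absorbed by the new factor J_(n+1) of M_(n+1). *)
Lemma expn_mass_le (n j : nat) : (J 0 <= j)%N -> j%:R ^+ n.+2 * pn j <= M n.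
Proof.
move=> Jj; have j2 : (2 <= j)%N.
  by rewrite (leq_trans _ Jj)// (leq_trans j0_ge2)// passage_ge.
elim: n => [|n IH].
  rewrite /M /passage_prod big_ord0; apply: expn_mass_le1 => //.
  exact: (q_passage q j0 q_mono q_lim 0).
have [Jn|Jn] := leqP (J n.+1) j.
  rewrite (@le_trans _ _ 1) ?passage_prod_ge1//.
  apply: expn_mass_le1 => //.
  exact: (q_passage q j0 q_mono q_lim n.+1).
rewrite /M /passage_prod big_ord_recr/= exprSr mulrAC.
rewrite ler_pM//.
- by rewrite mulr_ge0 ?exprn_ge0// ltW.
- by rewrite ler_nat ltnW.
Qed.

Lemma expn_le_passage_prod (n j : nat) : (j < J 0)%N -> j%:R ^+ n <= M n.
Proof.
move=> jJ; rewrite /M /passage_prod -[n in _ ^+ n]card_ord -prodr_const.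
apply: ler_prod => i _; rewrite ler0n ler_nat (leq_trans (ltnW jJ))//.
exact: (passage_mono q j0 q_mono q_lim).
Qed.

(** The constant is 3 = 1 + 2. Values j < J_0 contribute at most M_n times their total mass; values
    j >= J_0 contribute at most 2 M_n / j^2 each, and the sum of 2 / j^2 over j >= j0 is at most 4 /
    j0 <= 2. *)
Lemma moment_bound d (T : measurableType d) (P : probability T R) (X : {RV P >-> R}) :
  (forall t, exists j : nat, `|X t| = j%:R) ->
  (forall j : nat, (P [set t | (`|X t| = j%:R)%R] <= (2 * pn j)%:E)%E) ->
  forall n, (\int[P]_t (`|X t| ^+ n)%R%:E <= (3 * M n)%:E)%E.
Proof.
move=> X_nat mass n; pose F (j : nat) := [set t | `|X t| = j%:R].
have M0 : 0 <= M n by rewrite (le_trans ler01)// passage_prod_ge1.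
have mX : measurable_fun [set: T] (fun t => `|X t|) by apply: measurableT_comp.
have mF j : measurable (F j).
  rewrite (_ : F j = (fun t => `|X t|) @^-1` [set j%:R])//.
  by rewrite -[_ @^-1` _]setTI; apply: mX.
have tF : trivIset setT F.
  move=> i j _ _ [t [/= ti tj]]; apply/eqP.
  by rewrite -(eqr_nat R) -ti -tj.
have FT : \bigcup_j F j = setT.
  by apply/seteqP; split => // t _; have [j tj] := X_nat t; exists j.
rewrite -FT ge0_integral_bigcup//; last first.
  by apply/measurable_EFinP; rewrite FT; exact: measurable_funX.
have PF (N : nat) : \sum_(0 <= j < N) fine (P (F j)) <= 1.
  rewrite -lee_fin -sumEFin.
  under eq_bigr do rewrite fineK ?fin_num_measure//.
  rewrite big_mkord -measure_bigsetU//; first exact: probability_le1 (bigsetU_measurable _ _).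
apply: lime_le; first by apply: is_cvg_nneseries => j _ _; apply: integral_ge0.
apply: nearW => N.
have term j : (\int[P]_(t in F j) (`|X t| ^+ n)%R%:E <=
   (M n * (fine (P (F j)) + (if (j0 <= j)%N then 2 / j%:R ^+ 2 else 0)))%:E)%E.
  rewrite (_ : (\int[P]_(t in F j) _ = \int[P]_(t in F j) (cst (j%:R ^+ n)%:E) t)%E); last first.
    by apply: eq_integral => t; rewrite inE => /= ->.
  rewrite integral_cst// (_ : (_ * _)%E = (j%:R ^+ n * fine (P (F j)))%:E) ?lee_fin; last first.
    by rewrite EFinM fineK ?fin_num_measure.
  have PFj0 : 0 <= fine (P (F j)) by rewrite fine_ge0.
  have [Jj|jJ] := leqP (J 0) j.
    have jj : (j0 <= j)%N by rewrite (leq_trans _ Jj)// passage_ge.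
    rewrite jj (@le_trans _ _ (M n * (2 / j%:R ^+ 2)))//; last first.
      by rewrite ler_wpM2l// lerDr.
    have jpos : 0 < j%:R :> R by rewrite ltr0n (leq_trans _ jj)// (leq_trans _ j0_ge2).
    rewrite mulrA ler_pdivlMr ?exprn_gt0//.
    have Pj : fine (P (F j)) <= 2 * pn j.
      by rewrite -lee_fin fineK ?fin_num_measure//; exact: mass.
    rewrite (@le_trans _ _ (j%:R ^+ n * (2 * pn j) * j%:R ^+ 2))//.
      by rewrite ler_wpM2r ?exprn_ge0// ler_wpM2l ?exprn_ge0.
    have := expn_mass_le n j Jj; rewrite -addn2 exprD.
    by move: (j%:R ^+ n) (j%:R ^+ 2) => x y; lra.
  rewrite (@le_trans _ _ (M n * fine (P (F j))))//.
    by rewrite ler_wpM2r// expn_le_passage_prod.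
  by rewrite ler_wpM2l// lerDl; case: ifP => // _; rewrite divr_ge0 ?exprn_ge0.
apply: (@le_trans _ _ (\sum_(0 <= j < N) (M n * (fine (P (F j)) + (if (j0 <= j)%N then 2 / j%:R ^+ 2 else 0)))%:E)%E).
  by apply: lee_sum => j _; exact: term.
rewrite sumEFin lee_fin -mulr_sumr mulrC ler_wpM2r// big_split/=.
have : \sum_(0 <= j < N) (if (j0 <= j)%N then 2 / j%:R ^+ 2 else 0 : R) <= 2.
  rewrite -big_mkcond/= -(big_nat_widenl j0 0 N predT)// -mulr_sumr -[leRHS]mulr1 ler_wpM2l//.
  rewrite (le_trans (sum_inv_sqr_le R _ _ j0_ge2))//.
  by rewrite ler_pdivrMr ?mul1r ?ler_nat// ltr0n (leq_trans _ j0_ge2).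
by have := PF N; lra.
Qed.

End moment_bound.

(** * Series and roots in the extended reals *)

Lemma esum_int_sym (R : realType) (a : int -> \bar R) (j0 : nat) : (0 < j0)%N ->
  (forall j, (j0 <= `|j|)%N -> 0 <= a j)%E -> (forall j, a (- j) = a j) ->
  (\esum_(j in [set j : int | (j0 <= `|j|)%N]) a j =
   \sum_(n <oo | (j0 <= n)%N) a n%:Z%R + \sum_(n <oo | (j0 <= n)%N) a n%:Z%R)%E.
Proof.
move=> j0_gt0 a0 asym; rewrite (esumID (range Posz)); last by move=> j; exact: a0.
have -> : [set j : int | (j0 <= `|j|)%N] `&` range Posz = Posz @` [set n | (j0 <= n)%N].
  apply/seteqP; split => [j [/= jj [n _ nj]]|j [n /= jn <-]]; last by split => //; exists n.
  by exists n => //; move: jj; rewrite -nj.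
have -> : [set j : int | (j0 <= `|j|)%N] `&` ~` range Posz =
    (fun n : nat => - n%:Z) @` [set n | (j0 <= n)%N].
  apply/seteqP; split => [j [/= jj nj]|j [n /= jn <-]].
    exists `|j|%N => //; case: j jj nj => [n _ []|n _ _]; first by exists n.
    by rewrite NegzE abszN.
  split; first by rewrite /= abszN.
  move=> [m _ /eqP]; rewrite -subr_eq0 opprK -PoszD => /eqP[] /eqP.
  by rewrite addn_eq0 => /andP[_ /eqP n0]; move: jn j0_gt0; rewrite n0; case: (j0).
rewrite !esum_image; last 2 first.
- by move=> m n _ _ /oppr_inj[].
- by move=> m n _ _ [].
under [X in (_ + X)%E]eq_esum do rewrite asym.
by rewrite nneseries_esum// => n jn; apply: (a0 n%:Z).
Qed.

(** The doubled series is the form produced by [esum_int_sym]; partial sums bounded by A would bound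
    it by A + A. *)
Lemma partial_sums_unbounded (R : realType) (f : nat -> R) (j0 : nat) :
  (forall j, (j0 <= j)%N -> 0 <= f j) ->
  (\sum_(n <oo | (j0 <= n)%N) (f n)%:E + \sum_(n <oo | (j0 <= n)%N) (f n)%:E = +oo)%E ->
  forall A, exists N, A < \sum_(j0 <= j < N) f j.
Proof.
move=> f0 foo A; apply: contrapT => /forallNP H.
have : (\sum_(n <oo | (j0 <= n)%N) (f n)%:E <= A%:E)%E.
  apply: lime_le; first by apply: is_cvg_nneseries_cond => n _ jn; rewrite lee_fin f0.
  apply: nearW => N; rewrite sumEFin lee_fin.
  rewrite (_ : \sum_(0 <= i < N | (j0 <= i)%N) f i = \sum_(j0 <= j < N) f j); last first.
    by rewrite (big_nat_widenl j0 0 N predT).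
  by rewrite leNgt; apply/negP; exact: H.
move=> le; have := leeD le le; rewrite foo -EFinD leye_eq.
by [].
Qed.

Lemma inve_root_ge (R : realType) (e : \bar R) (x : R) (n : nat) : (0 < n)%N -> 0 < x ->
  (0 <= e)%E -> (e <= (x ^+ n)%R%:E)%E -> ((x^-1)%R%:E <= (e `^ (n%:R^-1)%R)^-1)%E.
Proof.
move=> n0 x0; case: e => [e||]//=; rewrite !lee_fin => e0 ex.
have ex' : e `^ n%:R^-1 <= x.
  have nn : n%:R != 0 :> R by rewrite pnatr_eq0 -lt0n.
  have -> : x = (x ^+ n) `^ n%:R^-1.
    by rewrite -powR_mulrn ?ltW// -powRrM mulfV// powRr1// ltW.
  by apply: ge0_ler_powR => //; rewrite ?nnegrE ?exprn_ge0 ?invr_ge0 ?ltW// ltW.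
(* A zero root has inverse +oo, so nothing remains to be shown in that case. *)
rewrite inver; case: ifPn => [_|ne]; first exact: leey.
by rewrite lee_fin lef_pV2// posrE lt_neqAle eq_sym ne powR_ge0.
Qed.

Lemma eseries_unbounded (R : realType) (u : nat -> \bar R) (v : nat -> R) (c : R) :
  0 < c -> (forall n, 0 <= u n)%E -> (forall n, (c * v n)%R%:E <= u n.+1)%E ->
  (forall A, exists K, A < \sum_(0 <= k < K) v k) ->
  (\sum_(1 <= k <oo) u k = +oo)%E.
Proof.
move=> c0 u0 vu H; apply/eqyP => A A0.
have [K HK] := H (A / c).
apply: (@le_trans _ _ (\sum_(1 <= k < K.+1) u k)%E); last first.
  by apply: nneseries_lim_ge => n _ _.
rewrite big_add1/=.
apply: (@le_trans _ _ (\sum_(0 <= k < K) (c * v k)%R%:E)%E); last first.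
  by apply: lee_sum => k _; exact: vu.
rewrite sumEFin lee_fin -mulr_sumr mulrC -ler_pdivrMr//; exact: ltW.
Qed.

(** * Moments of laws and determinacy *)

Definition mfun_of d (T : measurableType d) (R : realType) (f : T -> R)
    (mf : measurable_fun [set: T] f) : {mfun T >-> R} :=
  HB.pack f (isMeasurableFun.Build _ _ _ _ f mf).

Lemma distribution_moment d (T : measurableType d) (R : realType) (P : probability T R)
    (Y : {RV P >-> R}) (k : nat) :
  P.-integrable [set: T] (fun t => (Y t ^+ k)%:E) ->
  (distribution P Y).-integrable [set: R] (fun x => (x ^+ k)%:E) /\
  \int[distribution P Y]_x (x ^+ k) = \int[P]_t (Y t ^+ k).
Proof.
move=> Yk; have mk : measurable_fun [set: R] (fun x : R => (x ^+ k)%:E).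
  by apply/measurable_EFinP; exact: measurable_funX.
split; first by apply: integrable_pushforward.
by rewrite /Rintegral integral_distribution.
Qed.

Lemma norm_moment_integrable d (T : measurableType d) (R : realType) (P : probability T R)
    (X : {RV P >-> R}) (k : nat) : finite_moments P X ->
  P.-integrable [set: T] (fun t => (`|X t| ^+ k)%:E).
Proof.
case: k => [|k] Xmom.
  rewrite (_ : (fun t => _) = EFin \o cst 1); first exact: finite_measure_integrable_cst.
  by apply/funext => t /=; rewrite expr0.
apply/integrableP; split.
  by apply/measurable_EFinP; apply: measurable_funX; exact: measurableT_comp.
under eq_integral => t _ do rewrite /= ger0_norm ?exprn_ge0//.
by have := Xmom k.+1 isT; rewrite unlock.
Qed.

Lemma moment_integrable d (T : measurableType d) (R : realType) (P : probability T R)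
    (X : {RV P >-> R}) (k : nat) : finite_moments P X ->
  P.-integrable [set: T] (fun t => (X t ^+ k)%:E).
Proof.
move=> Xmom; apply: le_integrable (norm_moment_integrable d T R P X k Xmom) => //.
  by apply/measurable_EFinP; exact: measurable_funX.
by move=> t _ /=; rewrite lee_fin !normrX normr_id.
Qed.

Lemma finite_moments_sqr d (T : measurableType d) (R : realType) (P : probability T R)
    (X : {RV P >-> R}) : finite_moments P X ->
  finite_moments P (X ^+ 2 : {mfun T >-> R}).
Proof.
move=> Xmom k k0; have := Xmom (2 * k)%N; rewrite muln_gt0 k0 => /(_ isT).
rewrite (_ : (fun t => `|X t| ^+ (2 * k)%N) = (fun t => `|(X ^+ 2 : {mfun T >-> R}) t| ^+ k))//.
by apply/funext => t; rewrite exprM -normrX.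
Qed.

Section determinate.
Context d (T : measurableType d) (R : realType) (P : probability T R) (X : {RV P >-> R}).
Variables (J : nat -> R) (C : R).
Hypothesis C0 : 0 <= C.
Hypothesis J0 : forall n, 0 < J n.
Hypothesis Jnd : forall m n, (m <= n)%N -> J m <= J n.
Hypothesis Jdiv : forall A, exists K, A < \sum_(0 <= k < K) (J k.*2.+1)^-1.
Hypothesis X_mom : finite_moments P X.
Hypothesis XC : forall k, \int[P]_t (X t ^+ k.*2) <= C * \prod_(i < k.*2) J i.

Lemma hamburger_determinate (x_ : nat -> R) : (forall t, exists n, X t = x_ n) ->
  M_determinate_on [set: R] P X.
Proof.
move=> Xx; split => // mu _ mom A mA.
have dm k := distribution_moment d T R P X k (moment_integrable d T R P X k X_mom).
apply/esym; apply: (measure_eq_of_atoms R (distribution P X) mu x_) => //.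
- move=> n; apply: (atoms_eq (distribution P X) mu J C) => //.
  + by move=> k; have [] := dm k.
  + by move=> k; have [] := mom k.
  + by move=> k; have [_ ->] := dm k.*2.
  + by move=> k; have [_ ->] := dm k.*2; have [_] := mom k.*2; rewrite unlock /Rintegral => ->.
  + by move=> k; have [_ ->] := dm k; have [_] := mom k; rewrite unlock /Rintegral => ->.
- rewrite /distribution /pushforward -[RHS](probability_setT P); congr (P _).
  by apply/seteqP; split => // t _; have [n tn] := Xx t; exists n.
Qed.

(** The law of |X| is compared with that of the square root under [nu]: their even moments are the
    moments of X^2 and of [nu], and neither charges the negative half-line. *)
Lemma stieltjes_determinate (x_ : nat -> R) : (forall n, 0 <= x_ n) ->
  (forall t, exists n, `|X t| = x_ n) ->
  M_determinate_on `[0, +oo[%classic P (X ^+ 2 : {mfun T >-> R}).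
Proof.
move=> x0 Xx; split => [t||nu nu1 mom A mA].
- by rewrite /= in_itv/= andbT; exact: (sqr_ge0 (X t)).
- exact: finite_moments_sqr.
have mabs : measurable_fun [set: T] (fun t => `|X t|) by exact: measurableT_comp.
have msqrt : measurable_fun [set: R] (@Num.sqrt R).
  by apply: continuous_measurable_fun; exact: sqrt_continuous.
pose Y : {RV P >-> R} := mfun_of d T R _ mabs.
pose Z : {RV nu >-> R} := mfun_of _ _ R _ msqrt.
have mS : measurable (`[0, +oo[%classic : set R) by exact: measurable_itv.
have Ym k := distribution_moment d T R P Y k (norm_moment_integrable d T R P X k X_mom).
have sqrt_int k : nu.-integrable [set: R] (fun x => (Z x ^+ k)%:E).
  have [xk _] := mom k.
  (* The square root is at most 1 or at most x. *)
  apply: (@integrable_dominated _ _ _ (fun x => 1 + `|x ^+ k|)).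
  - exact: measurable_funX.
  - move=> x; rewrite (le_trans _ (ler_norm _))// ger0_norm ?exprn_ge0 ?sqrtr_ge0// /Z/=.
    have [x1|x1] := leP (Num.sqrt x) 1.
      by rewrite (@le_trans _ _ 1) ?exprn_ile1 ?sqrtr_ge0// lerDl.
    have x_gt0 : 0 < x by rewrite -sqrtr_gt0 (lt_trans _ x1).
    rewrite normrX (@le_trans _ _ (`|x| ^+ k)) ?lerDr//.
    rewrite lerXn2r ?nnegrE ?sqrtr_ge0// (ger0_norm (ltW x_gt0)).
    by rewrite -[leRHS](sqr_sqrtr (ltW x_gt0)) expr2 ler_peMl ?sqrtr_ge0// ltW.
  - have nxk : nu.-integrable [set: R] (EFin \o (fun x => `|x ^+ k|)).
      exact: integrable_norm.
    exact: (integrableD _ (finite_measure_integrable_cst nu 1 measurableT) nxk).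
have Zm k := distribution_moment _ _ R nu Z k (sqrt_int k).
have even_mom k : \int[P]_t (Y t ^+ k.*2) = \int[P]_t (X t ^+ k.*2).
  by apply: eq_Rintegral => t _; rewrite /Y/= -normrX ger0_norm// exprn_even_ge0// odd_double.
have even_eq k : \int[P]_t (Y t ^+ k.*2) = \int[nu]_x (Z x ^+ k.*2).
  rewrite even_mom.
  have [_ momk] := mom k.
  transitivity (\int[nu]_x (x ^+ k)).
    rewrite /Rintegral momk unlock; congr fine; apply: eq_integral => t _.
    by rewrite -muln2 mulnC exprM.
  (* The square of the root is x only for x >= 0, hence almost everywhere for [nu]. *)
  rewrite /Rintegral; congr fine; apply: ae_eq_integral => //.
  - by apply/measurable_EFinP; exact: measurable_funX.
  - by apply/measurable_EFinP; exact: measurable_funX.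
  exists (~` `[0, +oo[%classic); split.
  - exact: measurableC.
  - by apply: etrans (probability_setC nu mS) _; rewrite nu1 subee.
  - move=> x /=; apply: contra_not; rewrite in_itv/= andbT => xge0 _.
    by rewrite -muln2 mulnC exprM /Z/= sqr_sqrtr.
have atoms n : distribution P Y [set x_ n] = distribution nu Z [set x_ n].
  apply: (nonneg_atoms_eq (distribution P Y) (distribution nu Z) J C) => //.
  + by move=> k; have [] := Ym k.
  + by move=> k; have [] := Zm k.
  + by move=> k; have [_ ->] := Ym k.*2; rewrite even_mom.
  + by move=> k; have [_ ->] := Ym k.*2; have [_ ->] := Zm k.*2.
  + move=> c c0; have e : Y @^-1` [set c] = set0.
      by apply/seteqP; split => // t /= tc; move: c0; rewrite -tc ltNge normr_ge0.
    exact: etrans (congr1 P e) (measure0 P).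
  + move=> c c0; have e : Z @^-1` [set c] = set0.
      by apply/seteqP; split => // t /= tc; move: c0; rewrite -tc ltNge sqrtr_ge0.
    exact: etrans (congr1 nu e) (measure0 nu).
have Y1 : distribution P Y (range x_) = 1%E.
  rewrite -[RHS](probability_setT P); congr (P _).
  by apply/seteqP; split => // t _; have [n tn] := Xx t; exists n.
have msq : measurable_fun [set: R] (fun x : R => x ^+ 2) by exact: measurable_funX.
have mB : measurable ((fun x : R => x ^+ 2) @^-1` A).
  by rewrite -[_ @^-1` _]setTI; exact: msq.
(* The laws are compared on the preimage of A under squaring; pulled back by the root, it agrees
   with A on [0, oo). *)
have law_eq := measure_eq_of_atoms R _ _ x_ atoms Y1 _ mB.
have -> : distribution P (X ^+ 2 : {mfun T >-> R}) A =
    distribution P Y ((fun x : R => x ^+ 2) @^-1` A).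
  congr (P _); apply/seteqP; split => t /=; rewrite real_normK ?num_real//.
have mZ : measurable (Z @^-1` ((fun x : R => x ^+ 2) @^-1` A)).
  by rewrite -[_ @^-1` _]setTI; exact: (msqrt measurableT _ mB).
rewrite law_eq; apply: etrans (probability_setI nu mA mS nu1) _.
apply: etrans (esym (probability_setI nu mZ mS nu1)); congr (nu _).
apply/seteqP; split => x /= [xA]; rewrite in_itv/= andbT => x_ge0; split => //.
  by rewrite /Z/= sqr_sqrtr.
by move: xA; rewrite /Z/= sqr_sqrtr.
Qed.

End determinate.

Lemma passage_prod_le_expn (R : realType) (q : nat -> R) (j0 : nat)
    (q_mono : forall i j : nat, (j0 <= i)%N -> (i <= j)%N -> q i <= q j)
    (q_lim : q @ \oo --> +oo) (n : nat) :
  passage_prod q j0 q_lim n <= (passage q j0 q_lim n)%:R ^+ n.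
Proof.
rewrite /passage_prod -[n in _ ^+ n]card_ord -prodr_const.
apply: ler_prod => i _; rewrite ler0n ler_nat.
exact: passage_mono.
Qed.

(** * Carleman's condition and both determinacy statements *)

Theorem theorem3 (R : realType) (d : measure_display) (T : measurableType d)
    (P : probability T R) (X : {RV P >-> R})
    (X_int : forall t, exists j : int, X t = j%:~R)
    (p : int -> R)
    (pE : forall j : int, P (X @^-1` [set j%:~R]) = (p j)%:E)
    (p_gt0 : forall j : int, 0 < p j)
    (p_sum1 : (\esum_(j in [set: int]) (p j)%:E = 1)%E)
    (p_sym : forall j : int, p (- j) = p j)
    (X_mom : finite_moments P X)
    (j0 : nat) (j0_ge2 : (2 <= j0)%N)
    (p_div : (\esum_(j in [set j : int | (j0 <= `|j|)%N])
                (- ln (p j) / ((j%:~R) ^+ 2 * ln (`|j|%N%:R)))%:E = +oo)%E)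
    (p_mono : forall i j : nat, (j0 <= i)%N -> (i <= j)%N ->
        - ln (p i%:Z) / ln (i%:R) <= - ln (p j%:Z) / ln (j%:R))
    (p_lim : (fun j : nat => - ln (p j%:Z) / ln (j%:R)) @ \oo --> +oo) :
  [/\ Carleman_Hamburger P X,
      M_determinate_on [set: R] P X &
      M_determinate_on `[0, +oo[%classic P (X ^+ 2 : {mfun T >-> R})].
Proof.
pose q (j : nat) := - ln (p j%:Z) / ln (j%:R : R).
have q_mono : forall i j : nat, (j0 <= i)%N -> (i <= j)%N -> q i <= q j by exact: p_mono.
have q_lim : q @ \oo --> +oo by exact: p_lim.
have p_le1 j : p j <= 1 by rewrite -lee_fin -pE probability_le1.
have X_nat t : exists n : nat, `|X t| = n%:R.
  by have [j ->] := X_int t; exists `|j|%N; rewrite -intr_norm natr_absz.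
have mX (r : R) : measurable (X @^-1` [set r]).
  by rewrite -[_ @^-1` _]setTI; exact: measurable_funP.
(* Subadditivity also covers j = 0, where the two events coincide. *)
have mass (j : nat) : (P [set t | (`|X t| = j%:R)%R] <= (2 * p j%:Z)%:E)%E.
  rewrite (_ : [set t | _] = X @^-1` [set j%:~R] `|` X @^-1` [set (- j%:Z)%:~R]); last first.
    apply/seteqP; split => t /=.
      by case: (ger0P (X t)) => _ tj; [left|right; rewrite mulrNz -[X t]opprK tj].
    by case=> ->; rewrite ?mulrNz ?normrN ger0_norm.
  apply: (le_trans (measureU2 _ (mX _) (mX _))).
  have -> : 2 * p j%:Z = p j%:Z + p (- j%:Z) by rewrite p_sym; lra.
  by rewrite EFinD -!pE.
have bound := moment_bound (fun j : nat => p j%:Z) j0 j0_ge2 (fun j => p_gt0 _) q_mono q_lim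
  d T P X X_nat mass.
(* Shifted by one to match the factors of [passage_prod]: [J k.*2.+1] is J_(2k+2). *)
pose J n : R := (passage q j0 q_lim n.+1)%:R.
have J0 n : 0 < J n by rewrite ltr0n passage_gt0.
have Jnd m n : (m <= n)%N -> J m <= J n by move=> mn; rewrite ler_nat passage_mono.
have q_div : forall A, exists N, A < \sum_(j0 <= j < N) q j / (j%:R) ^+ 2.
  have f_ge0 (j : int) : (j0 <= `|j|)%N ->
      0 <= - ln (p j) / ((j%:~R) ^+ 2 * ln (`|j|%N%:R)).
    move=> jj; rewrite divr_ge0//; first by rewrite oppr_ge0 ln_le0.
    rewrite mulr_ge0 ?sqr_ge0// ln_ge0// ler1n (leq_trans _ jj)//.
    exact: leq_trans j0_ge2.
  move: p_div; rewrite esum_int_sym; last 3 first.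
  - exact: leq_trans j0_ge2.
  - by move=> j jj; rewrite lee_fin f_ge0.
  - by move=> j; rewrite p_sym mulrNz sqrrN abszN.
  move=> /partial_sums_unbounded H A; have [|N HN] := H _ A.
    by move=> j jj; exact: (f_ge0 j%:Z).
  exists N; move: HN; congr (_ < _); apply: eq_bigr => j _.
  by rewrite /q absz_nat invfM; ring.
have Jdiv : forall A, exists K, A < \sum_(0 <= k < K) (J k.*2.+1)^-1.
  exact: (passage_inv_diverges q j0 j0_ge2 q_mono q_lim).
have even_norm k t : `|X t| ^+ k.*2 = X t ^+ k.*2.
  by rewrite -normrX ger0_norm// exprn_even_ge0// odd_double.
have XC k : \int[P]_t (X t ^+ k.*2) <= 3 * \prod_(i < k.*2) J i.
  under eq_Rintegral do rewrite -even_norm.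
  rewrite -lee_fin /Rintegral fineK; first exact: bound.
  by apply: integrable_fin_num => //; exact: norm_moment_integrable.
have C0 : (0 : R) <= 3 by [].
split.
(* From E X^(2k+2) <= 3 M_(2k+2) <= (3 J_(2k+2))^(2k+2), the term of index k + 1 is at least 1 / (3
   J_(2k+2)). *)
- apply: (eseries_unbounded R _ (fun k => (J k.*2.+1)^-1) 3^-1) => //.
    by move=> k; rewrite inve_ge0 poweR_ge0.
  move=> k; rewrite -invfM; apply: inve_root_ge => //.
  + by rewrite mulr_gt0.
  + rewrite unlock integral_ge0// => t _.
    by rewrite lee_fin mulnC muln2 -even_norm exprn_ge0.
  + rewrite mul2n unlock; under eq_integral do rewrite -even_norm.
    rewrite (le_trans (bound _))// lee_fin exprMn ler_pM//.
    * by rewrite (le_trans ler01)// passage_prod_ge1.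
    * by rewrite doubleS exprS ler_peMr// exprn_ege1// ler1n.
    * exact: passage_prod_le_expn.
(* Even indices list the nonnegative integers and odd ones the nonpositive; 0 occurs twice. *)
- pose x_ n : R := if odd n then - (n./2)%:R else (n./2)%:R.
  apply: (hamburger_determinate d T R P X J 3 C0 J0 Jnd Jdiv X_mom XC x_) => t.
  have [j ->] := X_int t; case: j => n.
    by exists n.*2; rewrite /x_ odd_double doubleK.
  by exists n.+1.*2.+1; rewrite /x_/= odd_double/= uphalf_double NegzE mulrNz.
- apply: (stieltjes_determinate d T R P X J 3 C0 J0 Jnd Jdiv X_mom XC (fun n => n%:R)) => //.
Qed.
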